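(* Let $\alpha\in\{0,1\}^n$. If the differential on $\mathrm{ONH}_n$ induced by its skew polynomial representation $\mathrm{OPol}_n(\alpha)$ is diagrammatically local, then the differential of a crossing is the identity on two strands, i.e. $d(\partial_i)=1$ for all $1\le i\le n-1$, and either $\alpha=(0,1,0,1,\ldots)$ or $\alpha=(1,0,1,0,\ldots)$.
   Context: $\Bbbk$ is a commutative ring with unit. $\mathrm{OPol}_n=\Bbbk\langle x_1,\dots,x_n\rangle/(x_ix_j+x_jx_i,\ i\neq j)$ with $x_i$ odd, and odd derivation $d(x_i)=x_i^2$, $d(fg)=d(f)g+(-1)^{p(f)}f\,d(g)$ ($p$ = parity). For $\alpha\in\{0,1\}^n$, $\mathrm{OPol}_n(\alpha)$ is the free rank-one left $\mathrm{OPol}_n$-module on a generator $\mathbf 1_\alpha$ with dg module structure $d(f\mathbf 1_\alpha)=\bigl(d(f)+(-1)^{p(f)}f\sum_{i=1}^n\alpha_ix_i\bigr)\mathbf 1_\alpha$. The odd nilHecke algebra $\mathrm{ONH}_n$ is the $\Bbbk$-superalgebra with odd generators $x_1,\dots,x_n,\partial_1,\dots,\partial_{n-1}$ and relations $x_ix_j+x_jx_i=0$ ($i\ne j$); $\partial_i\partial_j+\partial_j\partial_i=0$ ($|i-j|>1$); $\partial_i^2=0$; $\partial_i\partial_{i+1}\partial_i=\partial_{i+1}\partial_i\partial_{i+1}$; $\partial_ix_j+x_j\partial_i=0$ ($j\neq i,i+1$); $x_i\partial_i+\partial_ix_{i+1}=1=\partial_ix_i+x_{i+1}\partial_i$. It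 acts faithfully on $\mathrm{OPol}_n(\alpha)$ by $\xi(f\mathbf 1_\alpha)=\xi(f)\mathbf 1_\alpha$, where $x_i$ acts on $\mathrm{OPol}_n$ by left multiplication and $\partial_i(x_j)=1$ if $j\in\{i,i+1\}$, $0$ otherwise, $\partial_i(fg)=\partial_i(f)g+(-1)^{p(f)}s_i(f)\partial_i(g)$, $s_i$ swapping $x_i$ and $x_{i+1}$. So $\mathrm{ONH}_n\subset\mathrm{END}_\Bbbk(\mathrm{OPol}_n(\alpha))$, and the induced differential is the restriction of $d(\varphi)=d\circ\varphi-(-1)^{p(\varphi)}\varphi\circ d$. Diagrammatically, $x_i$ is a dot on the $i$-th strand and $\partial_i$ a crossing of strands $i,i+1$. The induced differential is diagrammatically local if it preserves $\mathrm{ONH}_n$, $d(1)=0$, and it is determined by its values on the local generators (dot, crossing) extended compatibly with horizontal juxtaposition: i.e. there are elements $D_1\in\mathrm{ONH}_1$, $D_2\in\mathrm{ONH}_2$ (independent of $i$) such that $d(x_i)$ is $D_1$ placed on strand $i$ and $d(\partial_i)$ is $D_2$ placed on strands $i,i+1$ (replace $x_1,x_2,\partial_1$ in $D_2$ by $x_i,x_{i+1},\partial_i$).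
   Formalization: The formal theorem adds the hypothesis that 2 ≠ 0 in the commutative ring 𝕜; over a ring with 2 = 0 the claim fails, e.g. 𝕜 = F_2, n = 2, α = (0,0), where the differential is diagrammatically local but d(∂_1) = (x_1 − x_2)∂_1 ≠ 1. *)

(* Defs.v *)
From HB Require Import structures.
From mathcomp Require Import all_boot ssralg fingroup perm.
From mathcomp Require Import generic_quotient boolp zify.

Set Implicit Arguments.
Unset Strict Implicit.
Unset Printing Implicit Defensive.

Import GRing.Theory.
Local Open Scope ring_scope.
Local Open Scope quotient_scope.

(* Unital associative algebras over a commutative ring [k] presented by
   generators and relations: noncommutative polynomial expressions modulo the
   least congruence that contains the relations and the algebra axioms. *)

Inductive ncexpr (k G : Type) :=
  | Cst of k
  | Gen of G
  | Add of ncexpr k G & ncexpr k G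
  | Mul of ncexpr k G & ncexpr k G.
Arguments Cst {k G}.
Arguments Gen {k G}.

Declare Scope ncexpr_scope.
Delimit Scope ncexpr_scope with nc.
Bind Scope ncexpr_scope with ncexpr.
Notation "a + b" := (Add a b) : ncexpr_scope.
Notation "a * b" := (Mul a b) : ncexpr_scope.
Notation "0" := (Cst 0) : ncexpr_scope.
Notation "1" := (Cst 1) : ncexpr_scope.

HB.instance Definition _ k G := gen_eqMixin (ncexpr k G).
HB.instance Definition _ k G := gen_choiceMixin (ncexpr k G).

Section Presented.
Variables (k : comNzRingType) (G : Type).
Variable rels : ncexpr k G -> ncexpr k G -> Prop.
Implicit Types a b c : ncexpr k G.

Inductive ncongr : ncexpr k G -> ncexpr k G -> Prop :=
  | nc_rel a b : rels a b -> ncongr a b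
  | nc_refl a : ncongr a a
  | nc_sym a b : ncongr a b -> ncongr b a
  | nc_trans a b c : ncongr a b -> ncongr b c -> ncongr a c
  | nc_add a a' b b' : ncongr a a' -> ncongr b b' -> ncongr (a + b) (a' + b')
  | nc_mul a a' b b' : ncongr a a' -> ncongr b b' -> ncongr (a * b) (a' * b')
  | nc_addA a b c : ncongr (a + (b + c)) (a + b + c)
  | nc_addC a b : ncongr (a + b) (b + a)
  | nc_add0 a : ncongr (0 + a) a
  | nc_addN a : ncongr (Cst (-1) * a + a) 0
  | nc_mulA a b c : ncongr (a * (b * c)) (a * b * c)
  | nc_mul1l a : ncongr (1 * a) a
  | nc_mul1r a : ncongr (a * 1) a
  | nc_mulDl a b c : ncongr ((a + b) * c) (a * c + b * c)
  | nc_mulDr a b c : ncongr (a * (b + c)) (a * b + a * c)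
  | nc_cstD (s t : k) : ncongr (Cst (s + t)%R) (Cst s + Cst t)
  | nc_cstM (s t : k) : ncongr (Cst (s * t)%R) (Cst s * Cst t)
  | nc_cstC (s : k) a : ncongr (Cst s * a) (a * Cst s).

Definition ncongrb : rel (ncexpr k G) := fun a b => `[< ncongr a b >].

Fact ncongrb_refl : reflexive ncongrb.
Proof. by move=> a; apply/asboolP; exact: nc_refl. Qed.

Fact ncongrb_sym : symmetric ncongrb.
Proof. by move=> a b; apply/asboolP/asboolP; exact: nc_sym. Qed.

Fact ncongrb_trans : transitive ncongrb.
Proof.
by move=> b a c /asboolP ab /asboolP bc; apply/asboolP; exact: nc_trans bc.
Qed.

Canonical ncongrb_equiv := EquivRel ncongrb ncongrb_refl ncongrb_sym ncongrb_trans.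

Definition palg := {eq_quot ncongrb}.

HB.instance Definition _ := EqQuotient.on palg.
HB.instance Definition _ := Choice.on palg.

Definition pclass (a : ncexpr k G) : palg := \pi_palg a.

Lemma pclassP a b : pclass a = pclass b <-> ncongr a b.
Proof.
split=> [/eqmodP/asboolP // | ab].
by apply/eqmodP/asboolP.
Qed.

Lemma preprK : cancel (repr : palg -> _) pclass.
Proof. exact: reprK. Qed.

Lemma prepr_congr a : ncongr (repr (pclass a)) a.
Proof. by apply/pclassP; rewrite preprK. Qed.

Lemma palg_ind (P : palg -> Prop) : (forall a, P (pclass a)) -> forall u, P u.
Proof. by move=> Pc u; rewrite -[u]preprK. Qed.

Definition padd (u v : palg) : palg := pclass (repr u + repr v).
Definition pmul (u v : palg) : palg := pclass (repr u * repr v).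
Definition pcst (s : k) : palg := pclass (Cst s).
Definition popp (u : palg) : palg := pmul (pcst (-1)) u.
Definition pscale (s : k) (u : palg) : palg := pmul (pcst s) u.

Lemma paddE a b : padd (pclass a) (pclass b) = pclass (a + b).
Proof. by apply/pclassP; apply: nc_add; exact: prepr_congr. Qed.

Lemma pmulE a b : pmul (pclass a) (pclass b) = pclass (a * b).
Proof. by apply/pclassP; apply: nc_mul; exact: prepr_congr. Qed.

Fact paddA : associative padd.
Proof.
elim/palg_ind=> a; elim/palg_ind=> b; elim/palg_ind=> c.
by rewrite !paddE; apply/pclassP; exact: nc_addA.
Qed.
Fact paddC : commutative padd.
Proof.
elim/palg_ind=> a; elim/palg_ind=> b.
by rewrite !paddE; apply/pclassP; exact: nc_addC.
Qed.
Fact padd0 : left_id (pcst 0) padd.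
Proof. by elim/palg_ind=> a; rewrite !paddE; apply/pclassP; exact: nc_add0. Qed.
Fact paddN : left_inverse (pcst 0) popp padd.
Proof.
elim/palg_ind=> a; rewrite /popp pmulE paddE.
by apply/pclassP; exact: nc_addN.
Qed.
Fact pmulA : associative pmul.
Proof.
elim/palg_ind=> a; elim/palg_ind=> b; elim/palg_ind=> c.
by rewrite !pmulE; apply/pclassP; exact: nc_mulA.
Qed.
Fact pmul1l : left_id (pcst 1) pmul.
Proof. by elim/palg_ind=> a; rewrite !pmulE; apply/pclassP; exact: nc_mul1l. Qed.
Fact pmul1r : right_id (pcst 1) pmul.
Proof. by elim/palg_ind=> a; rewrite !pmulE; apply/pclassP; exact: nc_mul1r. Qed.
Fact pmulDl : left_distributive pmul padd.
Proof.
elim/palg_ind=> a; elim/palg_ind=> b; elim/palg_ind=> c.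
by rewrite !(paddE, pmulE); apply/pclassP; exact: nc_mulDl.
Qed.
Fact pmulDr : right_distributive pmul padd.
Proof.
elim/palg_ind=> a; elim/palg_ind=> b; elim/palg_ind=> c.
by rewrite !(paddE, pmulE); apply/pclassP; exact: nc_mulDr.
Qed.

HB.instance Definition _ :=
  GRing.isZmodule.Build palg paddA paddC padd0 paddN.
HB.instance Definition _ :=
  GRing.Zmodule_isPzRing.Build palg pmulA pmul1l pmul1r pmulDl pmulDr.

Lemma pclassD a b : pclass (a + b) = pclass a + pclass b.
Proof. by rewrite -paddE. Qed.
Lemma pclassM a b : pclass (a * b) = pclass a * pclass b.
Proof. by rewrite -pmulE. Qed.

Fact pcst_zmod_morphism : zmod_morphism pcst.
Proof.
move=> s t; apply: (addIr (pcst t)); rewrite addrNK -pclassD.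
by apply/esym/pclassP; rewrite -{1}(subrK t s); exact: nc_cstD.
Qed.
Fact pcst_monoid_morphism : monoid_morphism pcst.
Proof.
by split=> // s t; rewrite -pclassM; apply/pclassP; exact: nc_cstM.
Qed.
HB.instance Definition _ :=
  GRing.isZmodMorphism.Build k palg pcst pcst_zmod_morphism.
HB.instance Definition _ :=
  GRing.isMonoidMorphism.Build k palg pcst pcst_monoid_morphism.

Lemma pcst_central s (u : palg) : pcst s * u = u * pcst s.
Proof.
elim/palg_ind: u => a.
by rewrite -!pclassM; apply/pclassP; exact: nc_cstC.
Qed.

Fact pscaleA s t u : pscale s (pscale t u) = pscale (s * t) u.
Proof. by rewrite /pscale -[pmul]/(@GRing.mul _) rmorphM mulrA. Qed.
Fact pscale1 : left_id 1 pscale.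
Proof. by move=> u; exact: mul1r. Qed.
Fact pscaleDr : right_distributive pscale +%R.
Proof. by move=> s u v; exact: mulrDr. Qed.
Fact pscaleDl u : {morph pscale^~ u : s t / s + t}.
Proof. by move=> s t; rewrite /pscale -[pmul]/(@GRing.mul _) rmorphD mulrDl. Qed.
HB.instance Definition _ :=
  GRing.Zmodule_isLmodule.Build k palg pscaleA pscale1 pscaleDr pscaleDl.

Lemma pscaleE s (u : palg) : s *: u = pcst s * u.
Proof. by []. Qed.
Lemma pscaleAl s (u v : palg) : s *: (u * v) = s *: u * v.
Proof. by rewrite !pscaleE mulrA. Qed.
Lemma pscaleAr s (u v : palg) : s *: (u * v) = u * (s *: v).
Proof. by rewrite !pscaleE !mulrA pcst_central. Qed.

Definition pgen (g : G) : palg := pclass (Gen g).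

Lemma palg_rect_gen (P : palg -> Prop) :
    (forall s, P (pcst s)) -> (forall g, P (pgen g)) ->
    (forall u v, P u -> P v -> P (u + v)) ->
    (forall u v, P u -> P v -> P (u * v)) ->
  forall u, P u.
Proof.
move=> Pc Pg PD PM; elim/palg_ind; elim=> [s|g|a IHa b IHb|a IHa b IHb].
- exact: Pc.
- exact: Pg.
- by rewrite pclassD; exact: PD.
- by rewrite pclassM; exact: PM.
Qed.

Section Lift.
Variables (T : pzRingType) (cst : k -> T) (gen : G -> T).

Fixpoint plift_expr (a : ncexpr k G) : T :=
  match a with
  | Cst s => cst s
  | Gen g => gen g
  | Add a b => plift_expr a + plift_expr b
  | Mul a b => plift_expr a * plift_expr b
  end.

Definition plift (u : palg) : T := plift_expr (repr u).

End Lift.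

Section LiftTheory.
Variables (T : pzRingType) (cst : {rmorphism k -> T}) (gen : G -> T).
Hypothesis cst_central : forall s t, cst s * t = t * cst s.
Hypothesis gen_rels :
  forall a b, rels a b -> plift_expr cst gen a = plift_expr cst gen b.
Local Notation f := (plift cst gen).

Lemma plift_congr a b :
  ncongr a b -> plift_expr cst gen a = plift_expr cst gen b.
Proof.
elim=> {a b} /=.
- exact: gen_rels.
- by [].
- by move=> a b _ ->.
- by move=> a b c _ -> _ ->.
- by move=> a a' b b' _ -> _ ->.
- by move=> a a' b b' _ -> _ ->.
- by move=> a b c; rewrite addrA.
- by move=> a b; rewrite addrC.
- by move=> a; rewrite rmorph0 add0r.
- by move=> a; rewrite rmorph0 rmorphN1 mulN1r addNr.
- by move=> a b c; rewrite mulrA.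
- by move=> a; rewrite rmorph1 mul1r.
- by move=> a; rewrite rmorph1 mulr1.
- by move=> a b c; rewrite mulrDl.
- by move=> a b c; rewrite mulrDr.
- by move=> s t; rewrite rmorphD.
- by move=> s t; rewrite rmorphM.
- by move=> s a; rewrite cst_central.
Qed.

Lemma plift_class a : f (pclass a) = plift_expr cst gen a.
Proof. exact/plift_congr/prepr_congr. Qed.

Lemma plift_gen g : f (pgen g) = gen g. Proof. exact: plift_class. Qed.
Lemma plift_cst s : f (pcst s) = cst s. Proof. exact: plift_class. Qed.

Lemma pliftD u v : f (u + v) = f u + f v.
Proof.
by elim/palg_ind: u v => a; elim/palg_ind=> b; rewrite -pclassD !plift_class.
Qed.

Lemma pliftM u v : f (u * v) = f u * f v.
Proof.
by elim/palg_ind: u v => a; elim/palg_ind=> b; rewrite -pclassM !plift_class.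
Qed.

End LiftTheory.

(* [skewder tau delta] is the [tau]-derivation of [palg] over [k] which sends
   each generator [g] to [delta g]. *)
Section SkewDerivation.
Variables (tau : palg -> palg) (delta : G -> palg).

Fixpoint skewder_expr (a : ncexpr k G) : palg :=
  match a with
  | Cst _ => 0
  | Gen g => delta g
  | Add a b => skewder_expr a + skewder_expr b
  | Mul a b => skewder_expr a * pclass b + tau (pclass a) * skewder_expr b
  end.

Definition skewder (u : palg) : palg := skewder_expr (repr u).

Hypothesis tau_cst : forall s, tau (pcst s) = pcst s.
Hypothesis tauD : forall u v, tau (u + v) = tau u + tau v.
Hypothesis tauM : forall u v, tau (u * v) = tau u * tau v.
Hypothesis delta_rels :
  forall a b, rels a b -> skewder_expr a = skewder_expr b.

Lemma skewder_congr a b : ncongr a b -> skewder_expr a = skewder_expr b.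
Proof.
elim=> {a b} /=.
- exact: delta_rels.
- by [].
- by move=> a b _ ->.
- by move=> a b c _ -> _ ->.
- by move=> a a' b b' _ -> _ ->.
- by move=> a a' b b' aa' -> bb' ->; move/pclassP: aa' bb' => -> /pclassP ->.
- by move=> a b c; rewrite addrA.
- by move=> a b; rewrite addrC.
- by move=> a; rewrite add0r.
- by move=> a; rewrite mul0r add0r -[pclass _]/(pcst _) tau_cst rmorphN1 mulN1r addNr.
- by move=> a b c; rewrite !pclassM tauM mulrDr mulrDl !mulrA addrA.
- by move=> a; rewrite mul0r add0r -[pclass _]/(pcst _) tau_cst rmorph1 mul1r.
- by move=> a; rewrite mulr0 addr0 -[pclass 1]/(pcst _) rmorph1 mulr1.
- by move=> a b c; rewrite pclassD tauD !mulrDl addrACA.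
- by move=> a b c; rewrite pclassD !mulrDr addrACA.
- by move=> s t; rewrite addr0.
- by move=> s t; rewrite mul0r mulr0 addr0.
- by move=> s a; rewrite mul0r mulr0 add0r addr0 -[pclass (Cst s)]/(pcst s) tau_cst pcst_central.
Qed.

Lemma skewder_class a : skewder (pclass a) = skewder_expr a.
Proof. exact/skewder_congr/prepr_congr. Qed.

Lemma skewder_gen g : skewder (pgen g) = delta g.
Proof. exact: skewder_class. Qed.
Lemma skewder_cst s : skewder (pcst s) = 0. Proof. exact: skewder_class. Qed.

Lemma skewderD u v : skewder (u + v) = skewder u + skewder v.
Proof.
by elim/palg_ind: u v => a; elim/palg_ind=> b; rewrite -pclassD !skewder_class.
Qed.

Lemma skewderM u v : skewder (u * v) = skewder u * v + tau u * skewder v.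
Proof.
by elim/palg_ind: u v => a; elim/palg_ind=> b; rewrite -pclassM !skewder_class.
Qed.

End SkewDerivation.

Section Action.
Variables (M : lmodType k) (op : G -> M -> M).

Fixpoint pact_expr (a : ncexpr k G) (m : M) : M :=
  match a with
  | Cst s => s *: m
  | Gen g => op g m
  | Add a b => pact_expr a m + pact_expr b m
  | Mul a b => pact_expr a (pact_expr b m)
  end.

Definition pact (u : palg) (m : M) : M := pact_expr (repr u) m.

Hypothesis op_linear : forall g, linear (op g).
Hypothesis op_rels : forall a b, rels a b -> pact_expr a =1 pact_expr b.

Lemma pact_expr_linear a : linear (pact_expr a).
Proof.
elim: a => [s|g|a IHa b IHb|a IHa b IHb] t m m' /=.
- by rewrite scalerDr !scalerA mulrC.
- exact: op_linear.
- by rewrite IHa IHb scalerDr addrACA.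
- by rewrite IHb IHa.
Qed.

Lemma pact_exprD a m m' : pact_expr a (m + m') = pact_expr a m + pact_expr a m'.
Proof. by have := pact_expr_linear a 1 m m'; rewrite !scale1r. Qed.
Lemma pact_expr0 a : pact_expr a 0 = 0.
Proof. by apply: (addIr (pact_expr a 0)); rewrite -pact_exprD !add0r. Qed.
Lemma pact_exprZ a s m : pact_expr a (s *: m) = s *: pact_expr a m.
Proof. by have := pact_expr_linear a s m 0; rewrite pact_expr0 !addr0. Qed.

Lemma pact_congr a b : ncongr a b -> pact_expr a =1 pact_expr b.
Proof.
elim=> {a b} /=.
- exact: op_rels.
- by [].
- by move=> a b _ E m; rewrite E.
- by move=> a b c _ E _ E' m; rewrite E E'.
- by move=> a a' b b' _ E _ E' m; rewrite E E'.
- by move=> a a' b b' _ E _ E' m; rewrite E E'.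
- by move=> a b c m; rewrite addrA.
- by move=> a b m; rewrite addrC.
- by move=> a m; rewrite scale0r add0r.
- by move=> a m; rewrite scaleN1r scale0r addNr.
- by [].
- by move=> a m; rewrite scale1r.
- by move=> a m; rewrite scale1r.
- by [].
- by move=> a b c m; rewrite pact_exprD.
- by move=> s t m; rewrite scalerDl.
- by move=> s t m; rewrite scalerA.
- by move=> s a m; rewrite pact_exprZ.
Qed.

Lemma pact_class a : pact (pclass a) =1 pact_expr a.
Proof. exact/pact_congr/prepr_congr. Qed.

Lemma pact_gen g : pact (pgen g) =1 op g. Proof. exact: pact_class. Qed.
Lemma pact_cst s m : pact (pcst s) m = s *: m. Proof. exact: pact_class. Qed.

Lemma pactD u v m : pact (u + v) m = pact u m + pact v m.
Proof.
by elim/palg_ind: u v => a; elim/palg_ind=> b; rewrite -pclassD !pact_class.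
Qed.

Lemma pactM u v m : pact (u * v) m = pact u (pact v m).
Proof.
by elim/palg_ind: u v => a; elim/palg_ind=> b; rewrite -pclassM !pact_class.
Qed.

Lemma pact_linear u : linear (pact u).
Proof. exact: pact_expr_linear. Qed.

End Action.

End Presented.

Section StrandIndices.
Variable n : nat.

(* Strands are numbered 0, ..., n-1 and crossings 0, ..., n-2; the crossing
   [i] involves the strands [lo i] = i and [hi i] = i+1. *)
Definition lo (i : 'I_n.-1) : 'I_n := widen_ord (leq_pred n) i.

Fact hi_subproof (i : 'I_n.-1) : (i.+1 < n)%N.
Proof. by rewrite -ltn_predRL. Qed.
Definition hi (i : 'I_n.-1) : 'I_n := Ordinal (hi_subproof i).

Definition touches (i : 'I_n.-1) (j : 'I_n) : bool := (j == lo i) || (j == hi i).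

Lemma touchesE i j : touches i j = (j == i :> nat) || (j == i.+1 :> nat).
Proof. by []. Qed.

Lemma val_swap (i : 'I_n.-1) (j : 'I_n) :
  tperm (lo i) (hi i) j =
    (if j == i :> nat then i.+1
     else if j == i.+1 :> nat then nat_of_ord i else nat_of_ord j) :> nat.
Proof.
by case: tpermP => [->|->|/eqP/negPf + /eqP/negPf]; rewrite -?val_eqE /= ?eqxx //;
  [rewrite gtn_eqF | move=> -> ->].
Qed.

End StrandIndices.

Section OddPolynomials.
Variables (k : comNzRingType) (n : nat).

Inductive OPol_rel : ncexpr k 'I_n -> ncexpr k 'I_n -> Prop :=
  | OPol_anticomm i j : i != j -> OPol_rel (Gen i * Gen j + Gen j * Gen i) 0.

Definition OPol := palg OPol_rel.
HB.instance Definition _ := GRing.PzRing.on OPol.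
HB.instance Definition _ := GRing.Lmodule.on OPol.

Definition X (j : 'I_n) : OPol := pgen OPol_rel j.

Lemma X_anticomm i j : i != j -> X i * X j = - (X j * X i).
Proof.
move=> ij; apply/eqP; rewrite -addr_eq0; apply/eqP.
by rewrite -!pclassM -pclassD; apply/pclassP/nc_rel/OPol_anticomm.
Qed.

Lemma X_sq_comm i j : i != j -> X i * X j ^+ 2 = X j ^+ 2 * X i.
Proof.
move=> ij; rewrite expr2 mulrA (X_anticomm ij) mulNr -!mulrA (X_anticomm ij).
by rewrite mulrN opprK.
Qed.

Lemma OPol_ind (P : OPol -> Prop) :
    P 1 -> (forall f g, P f -> P g -> P (f + g)) ->
    (forall s f, P f -> P (s *: f)) ->
    (forall j f, P f -> P (X j * f)) ->
  forall f, P f.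
Proof.
move=> P1 PD PZ PX f; rewrite -[f]mulr1.
elim/palg_rect_gen: f (1 : OPol) P1 => [s|j|u v IHu IHv|u v IHu IHv] g Pg.
- exact: PZ.
- exact: PX.
- by rewrite mulrDl; apply: PD; [exact: IHu|exact: IHv].
- by rewrite -mulrA; apply: IHu; exact: IHv.
Qed.

(* The Z/2-grading for which every [X j] is odd. *)
Inductive homog : bool -> OPol -> Prop :=
  | homog0 p : homog p 0
  | homog1 : homog false 1
  | homogX j : homog true (X j)
  | homogZ p s f : homog p f -> homog p (s *: f)
  | homogD p f g : homog p f -> homog p g -> homog p (f + g)
  | homogM p q f g : homog p f -> homog q g -> homog (p (+) q) (f * g).

(* The parity involution, f |-> (-1)^p(f) f on homogeneous f. *)
Definition sgn : OPol -> OPol := plift (pcst OPol_rel) (fun j => - X j).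

Fact sgn_rels a b : OPol_rel a b ->
  plift_expr (pcst OPol_rel) (fun j => - X j) a =
  plift_expr (pcst OPol_rel) (fun j => - X j) b.
Proof. by case=> i j ij /=; rewrite !mulrNN X_anticomm // addNr rmorph0. Qed.

Lemma sgnX j : sgn (X j) = - X j.
Proof. exact: (plift_gen (@pcst_central _ _ _) sgn_rels). Qed.
Lemma sgn_cst s : sgn (pcst _ s) = pcst _ s.
Proof. exact: (plift_cst (@pcst_central _ _ _) sgn_rels). Qed.
Lemma sgnD f g : sgn (f + g) = sgn f + sgn g.
Proof. exact: (pliftD (@pcst_central _ _ _) sgn_rels). Qed.
Lemma sgnM f g : sgn (f * g) = sgn f * sgn g.
Proof. exact: (pliftM (@pcst_central _ _ _) sgn_rels). Qed.
Lemma sgn1 : sgn 1 = 1. Proof. exact: sgn_cst. Qed.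

Fact sgn_linear : linear sgn.
Proof. by move=> s f g; rewrite sgnD !pscaleE sgnM sgn_cst. Qed.
HB.instance Definition _ := GRing.isLinear.Build k OPol OPol *:%R sgn sgn_linear.

Lemma sgnK : involutive sgn.
Proof.
elim/OPol_ind=> [|f g IHf IHg|s f IHf|j f IHf].
- by rewrite !sgn1.
- by rewrite !sgnD IHf IHg.
- by rewrite !linearZ /= IHf.
- by rewrite !sgnM sgnX linearN /= sgnX opprK IHf.
Qed.

Lemma homog_sgn p f : homog p f -> sgn f = (-1) ^+ p * f.
Proof.
elim=> {p f} [p||j|p s f _ IH|p f g _ IHf _ IHg|p q f g _ IHf _ IHg].
- by rewrite linear0 mulr0.
- by rewrite sgn1 expr0 mul1r.
- by rewrite sgnX expr1 mulN1r.
- by rewrite linearZ /= IH pscaleAr.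
- by rewrite linearD /= IHf IHg mulrDr.
- rewrite sgnM IHf IHg signr_addb -!mulrA; congr (_ * _).
  by rewrite !mulrA; congr (_ * _); exact: commr_sign.
Qed.

(* The odd derivation with d(x_i) = x_i^2. *)
Definition dOPol : OPol -> OPol := skewder sgn (fun j => X j ^+ 2).

Fact dOPol_rels a b : OPol_rel a b ->
  skewder_expr sgn (fun j => X j ^+ 2) a = skewder_expr sgn (fun j => X j ^+ 2) b.
Proof.
case=> i j ij /=; rewrite -[pclass _ (Gen i)]/(X i) -[pclass _ (Gen j)]/(X j).
rewrite !sgnX !mulNr (X_sq_comm ij) (X_sq_comm (_ : j != i)) 1?eq_sym //.
by rewrite addrA subrK subrr.
Qed.

Lemma dOPolX j : dOPol (X j) = X j ^+ 2.
Proof. exact: (skewder_gen sgn_cst sgnD sgnM dOPol_rels). Qed.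
Lemma dOPol_cst s : dOPol (pcst _ s) = 0.
Proof. exact: (skewder_cst sgn_cst sgnD sgnM dOPol_rels). Qed.
Lemma dOPolD f g : dOPol (f + g) = dOPol f + dOPol g.
Proof. exact: (skewderD sgn_cst sgnD sgnM dOPol_rels). Qed.
Lemma dOPolM f g : dOPol (f * g) = dOPol f * g + sgn f * dOPol g.
Proof. exact: (skewderM sgn_cst sgnD sgnM dOPol_rels). Qed.

Lemma dOPol_leibniz p f g :
  homog p f -> dOPol (f * g) = dOPol f * g + (-1) ^+ p * f * dOPol g.
Proof. by move=> fp; rewrite dOPolM (homog_sgn fp). Qed.

Fact dOPol_linear : linear dOPol.
Proof.
by move=> s f g; rewrite dOPolD !pscaleE dOPolM dOPol_cst mul0r add0r sgn_cst.
Qed.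
HB.instance Definition _ :=
  GRing.isLinear.Build k OPol OPol *:%R dOPol dOPol_linear.

Section Demazure.
Variable i : 'I_n.-1.

Definition swapX : OPol -> OPol :=
  plift (pcst OPol_rel) (fun j => X (tperm (lo i) (hi i) j)).

Fact swapX_rels a b : OPol_rel a b ->
  plift_expr (pcst OPol_rel) (fun j => X (tperm (lo i) (hi i) j)) a =
  plift_expr (pcst OPol_rel) (fun j => X (tperm (lo i) (hi i) j)) b.
Proof.
by case=> j l jl /=; rewrite X_anticomm ?addNr ?rmorph0 // (inj_eq perm_inj).
Qed.

Lemma swapXX j : swapX (X j) = X (tperm (lo i) (hi i) j).
Proof. exact: (plift_gen (@pcst_central _ _ _) swapX_rels). Qed.
Lemma swapX_cst s : swapX (pcst _ s) = pcst _ s.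
Proof. exact: (plift_cst (@pcst_central _ _ _) swapX_rels). Qed.
Lemma swapXD f g : swapX (f + g) = swapX f + swapX g.
Proof. exact: (pliftD (@pcst_central _ _ _) swapX_rels). Qed.
Lemma swapXM f g : swapX (f * g) = swapX f * swapX g.
Proof. exact: (pliftM (@pcst_central _ _ _) swapX_rels). Qed.

Fact swapX_linear : linear swapX.
Proof. by move=> s f g; rewrite swapXD !pscaleE swapXM swapX_cst. Qed.
HB.instance Definition _ :=
  GRing.isLinear.Build k OPol OPol *:%R swapX swapX_linear.

Definition swap_sgn (f : OPol) : OPol := swapX (sgn f).

Fact swap_sgn_cst s : swap_sgn (pcst _ s) = pcst _ s.
Proof. by rewrite /swap_sgn sgn_cst swapX_cst. Qed.
Fact swap_sgnD f g : swap_sgn (f + g) = swap_sgn f + swap_sgn g.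
Proof. by rewrite /swap_sgn sgnD swapXD. Qed.
Fact swap_sgnM f g : swap_sgn (f * g) = swap_sgn f * swap_sgn g.
Proof. by rewrite /swap_sgn sgnM swapXM. Qed.

(* The odd divided difference operator. *)
Definition demaz : OPol -> OPol := skewder swap_sgn (fun j => (touches i j)%:R).

Fact demaz_rels a b : OPol_rel a b ->
  skewder_expr swap_sgn (fun j => (touches i j)%:R) a =
  skewder_expr swap_sgn (fun j => (touches i j)%:R) b.
Proof.
case=> j l jl /=; rewrite -[pclass _ (Gen j)]/(X j) -[pclass _ (Gen l)]/(X l).
have lohi : lo i != hi i by rewrite -val_eqE /= ltn_eqF.
rewrite /swap_sgn !sgnX !linearN /= !swapXX /touches.
case: (tpermP _ _ j) jl => [->|->|/eqP/negPf nj /eqP/negPf nj'];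
  case: (tpermP _ _ l) => [->|->|/eqP/negPf nl /eqP/negPf nl'];
  rewrite ?eqxx ?orbT ?nj ?nj' ?nl ?nl' //= ?mulr1 ?mul1r ?mulr0 ?mul0r
    ?addr0 ?add0r ?subrr ?addNr //.
- by rewrite addr0.
- by rewrite addr0.
Qed.

Lemma demazX j : demaz (X j) = (touches i j)%:R.
Proof. exact: (skewder_gen swap_sgn_cst swap_sgnD swap_sgnM demaz_rels). Qed.
Lemma demaz_cst s : demaz (pcst _ s) = 0.
Proof. exact: (skewder_cst swap_sgn_cst swap_sgnD swap_sgnM demaz_rels). Qed.
Lemma demazD f g : demaz (f + g) = demaz f + demaz g.
Proof. exact: (skewderD swap_sgn_cst swap_sgnD swap_sgnM demaz_rels). Qed.
Lemma demazM f g : demaz (f * g) = demaz f * g + swapX (sgn f) * demaz g.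
Proof. exact: (skewderM swap_sgn_cst swap_sgnD swap_sgnM demaz_rels). Qed.

Lemma demaz_leibniz p f g :
  homog p f -> demaz (f * g) = demaz f * g + (-1) ^+ p * swapX f * demaz g.
Proof.
move=> fp; rewrite demazM (homog_sgn fp) swapXM; congr (_ + _ * _ * _).
by case: p {fp}; rewrite ?expr1 ?expr0 ?linearN /= [swapX 1]swapX_cst.
Qed.

Fact demaz_linear : linear demaz.
Proof.
by move=> s f g; rewrite demazD !pscaleE demazM demaz_cst mul0r add0r sgn_cst swapX_cst.
Qed.
HB.instance Definition _ :=
  GRing.isLinear.Build k OPol OPol *:%R demaz demaz_linear.

Lemma demazXM j f :
  demaz (X j * f) = f *+ touches i j - X (tperm (lo i) (hi i) j) * demaz f.
Proof. by rewrite demazM demazX sgnX linearN /= swapXX mulNr mulr_natl. Qed.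

End Demazure.

Lemma demaz1 i : demaz i 1 = 0. Proof. exact: demaz_cst. Qed.

Lemma demaz_sq i f : demaz i (demaz i f) = 0.
Proof.
elim/OPol_ind: f => [|f g IHf IHg|s f IHf|j f IHf].
- by rewrite demaz1 linear0.
- by rewrite !linearD /= IHf IHg addr0.
- by rewrite !linearZ /= IHf scaler0.
rewrite demazXM linearB linearMn /= demazXM IHf mulr0 subr0.
suff -> : touches i (tperm (lo i) (hi i) j) = touches i j by rewrite subrr.
by rewrite !touchesE val_swap; do ![case: eqP => //=]; lia.
Qed.

Lemma demaz_far (i j : 'I_n.-1) f : (i.+1 < j)%N || (j.+1 < i)%N ->
  demaz i (demaz j f) + demaz j (demaz i f) = 0.
Proof.
move=> ij; elim/OPol_ind: f => [|f g IHf IHg|s f IHf|l f IHf].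
- by rewrite !demaz1 !linear0 addr0.
- by rewrite !linearD /= addrACA IHf IHg addr0.
- by rewrite !linearZ /= -scalerDr IHf scaler0.
rewrite !demazXM !linearB !linearMn /= !demazXM.
have -> : touches i (tperm (lo j) (hi j) l) = touches i l.
  by rewrite !touchesE val_swap; do ![case: eqP => //=]; lia.
have -> : touches j (tperm (lo i) (hi i) l) = touches j l.
  by rewrite !touchesE val_swap; do ![case: eqP => //=]; lia.
have -> : tperm (lo i) (hi i) (tperm (lo j) (hi j) l)
        = tperm (lo j) (hi j) (tperm (lo i) (hi i) l).
  by apply: val_inj; rewrite /= !val_swap; do ![case: eqP => //=]; lia.
move/eqP: IHf; rewrite addr_eq0 => /eqP ->.
rewrite mulrN opprK opprB [X in _ + X]addrA [LHS]addrA subrK.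
by rewrite subrr.
Qed.

Lemma demaz_braid (i j : 'I_n.-1) f : j = i.+1 :> nat ->
  demaz i (demaz j (demaz i f)) = demaz j (demaz i (demaz j f)).
Proof.
move=> ij; elim/OPol_ind: f => [|f g IHf IHg|s f IHf|l f IHf].
- by rewrite !demaz1 !linear0.
- by rewrite !linearD /= IHf IHg.
- by rewrite !linearZ /= IHf.
rewrite !demazXM !(linearB, linearMn) /= !demazXM !(linearB, linearMn) /=.
rewrite !demazXM !demaz_sq IHf.
have -> : tperm (lo i) (hi i) (tperm (lo j) (hi j) (tperm (lo i) (hi i) l))
        = tperm (lo j) (hi j) (tperm (lo i) (hi i) (tperm (lo j) (hi j) l)).
  by apply: val_inj; rewrite /= !val_swap; do ![case: eqP => //=]; lia.
have -> : touches i (tperm (lo j) (hi j) (tperm (lo i) (hi i) l)) = touches j l.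
  by rewrite !touchesE !val_swap; do ![case: eqP => //=]; lia.
have -> : touches j (tperm (lo i) (hi i) (tperm (lo j) (hi j) l)) = touches i l.
  by rewrite !touchesE !val_swap; do ![case: eqP => //=]; lia.
by rewrite !opprK oppr0 !mul0rn !add0r addrCA.
Qed.

End OddPolynomials.

Section OddNilHecke.
Variables (k : comNzRingType) (n : nat).

Inductive ONH_gen := Dot of 'I_n | Crossing of 'I_n.-1.

Local Notation x i := (Gen (Dot i)).
Local Notation D i := (Gen (Crossing i)).

Inductive ONH_rel : ncexpr k ONH_gen -> ncexpr k ONH_gen -> Prop :=
  | ONH_dot_dot i j : i != j -> ONH_rel (x i * x j + x j * x i) 0
  | ONH_far (i j : 'I_n.-1) : (i.+1 < j)%N || (j.+1 < i)%N ->
      ONH_rel (D i * D j + D j * D i) 0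
  | ONH_sq i : ONH_rel (D i * D i) 0
  | ONH_braid (i j : 'I_n.-1) : j = i.+1 :> nat ->
      ONH_rel (D i * D j * D i) (D j * D i * D j)
  | ONH_cross_dot i j : ~~ touches i j -> ONH_rel (D i * x j + x j * D i) 0
  | ONH_slide_l i : ONH_rel (x (lo i) * D i + D i * x (hi i)) 1
  | ONH_slide_r i : ONH_rel (D i * x (lo i) + x (hi i) * D i) 1.

Definition ONH := palg ONH_rel.
HB.instance Definition _ := GRing.PzRing.on ONH.
HB.instance Definition _ := GRing.Lmodule.on ONH.

Definition dot (i : 'I_n) : ONH := pgen ONH_rel (Dot i).
Definition crossing (i : 'I_n.-1) : ONH := pgen ONH_rel (Crossing i).

Definition ONH_op (g : ONH_gen) (f : OPol k n) : OPol k n :=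
  match g with Dot i => X k i * f | Crossing i => demaz i f end.

(* The skew polynomial representation. An element [f 1_alpha] of the free
   rank-one module OPol_n(alpha) is represented by its coefficient [f]; the
   action of ONH_n does not depend on [alpha], the differential does. *)
Definition rho : ONH -> OPol k n -> OPol k n := pact ONH_op.

Fact ONH_op_linear g : linear (ONH_op g).
Proof.
case: g => i s f g /=; last exact: linearP.
by rewrite mulrDr -pscaleAr.
Qed.

Fact ONH_op_rels a b : ONH_rel a b -> pact_expr ONH_op a =1 pact_expr ONH_op b.
Proof.
have lohi i : lo i != hi i :> 'I_n by rewrite -val_eqE /= ltn_eqF.
case=> {a b} [i j ij|i j ij|i|i j ij|i j ij|i|i] f /=; rewrite ?scale0r ?scale1r.
- by rewrite !mulrA (X_anticomm _ ij) mulNr addNr.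
- exact: demaz_far.
- exact: demaz_sq.
- exact: demaz_braid.
- move: (ij); rewrite negb_or => /andP[jl jh].
  by rewrite demazXM (negPf ij) sub0r tpermD 1?eq_sym // addNr.
- by rewrite demazXM /touches eqxx orbT tpermR addrC subrK.
- by rewrite demazXM /touches eqxx tpermL subrK.
Qed.

Lemma rho_dot i f : rho (dot i) f = X k i * f.
Proof. exact: (pact_gen ONH_op_linear ONH_op_rels). Qed.
Lemma rho_crossing i f : rho (crossing i) f = demaz i f.
Proof. exact: (pact_gen ONH_op_linear ONH_op_rels). Qed.
Lemma rho_cst s f : rho (pcst _ s) f = s *: f.
Proof. exact: (pact_cst ONH_op_linear ONH_op_rels). Qed.
Lemma rhoD u v f : rho (u + v) f = rho u f + rho v f.
Proof. exact: (pactD ONH_op_linear ONH_op_rels). Qed.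
Lemma rhoM u v f : rho (u * v) f = rho u (rho v f).
Proof. exact: (pactM ONH_op_linear ONH_op_rels). Qed.
Lemma rho1 f : rho 1 f = f.
Proof. by rewrite rho_cst scale1r. Qed.

HB.instance Definition _ u := GRing.isLinear.Build k (OPol k n) (OPol k n) *:%R
  (rho u) (pact_linear ONH_op_linear u).

End OddNilHecke.
Arguments dot {k n} i.
Arguments crossing {k n} i.

Section Differential.
Variables (k : comNzRingType) (n : nat) (alpha : {ffun 'I_n -> bool}).
Local Notation M := (OPol k n).

(* d(f 1_alpha) = (d(f) + (-1)^p(f) f (alpha_1 x_1 + ... + alpha_n x_n)) 1_alpha *)
Definition dmod (f : M) : M :=
  dOPol f + sgn f * \sum_(i < n) (alpha i)%:R *: X k i.

Fact dmod_linear : linear dmod.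
Proof.
move=> s f g; rewrite /dmod !linearD !linearZ /= mulrDl -pscaleAl.
by rewrite addrACA.
Qed.
HB.instance Definition _ := GRing.isLinear.Build k M M *:%R dmod dmod_linear.

Lemma dmod_homog p f : homog p f ->
  dmod f = dOPol f + (-1) ^+ p * f * \sum_(i < n) (alpha i)%:R *: X k i.
Proof. by move=> fp; rewrite /dmod (homog_sgn fp). Qed.

(* The parity involution of END(M): phi |-> (-1)^p(phi) phi on homogeneous phi. *)
Definition sgnEND (phi : M -> M) (f : M) : M := sgn (phi (sgn f)).

Definition dEND (phi : M -> M) (f : M) : M :=
  dmod (phi f) - sgnEND phi (dmod f).

Lemma homog_split (f : M) :
  exists g h, [/\ homog false g, homog true h & f = g + h].
Proof.
elim/OPol_ind: f => [|f f' [g [h [Hg Hh ->]]] [g' [h' [Hg' Hh' ->]]]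
  |s f [g [h [Hg Hh ->]]]|j f [g [h [Hg Hh ->]]]].
- by exists 1, 0; split; [exact: homog1|exact: homog0|rewrite addr0].
- by exists (g + g'), (h + h'); split; [exact: homogD|exact: homogD|rewrite addrACA].
- by exists (s *: g), (s *: h); split; [exact: homogZ|exact: homogZ|rewrite scalerDr].
- exists (X k j * h), (X k j * g); split; last by rewrite mulrDr addrC.
    exact: (@homogM k n true true _ _ (homogX _ _) Hh).
  exact: (@homogM k n true false _ _ (homogX _ _) Hg).
Qed.

Lemma sgnEND_homog p (phi : {linear M -> M}) :
    (forall q f, homog q f -> homog (p (+) q) (phi f)) ->
  forall f, sgnEND phi f = (-1) ^+ p * phi f.
Proof.
move=> phip f; rewrite /sgnEND /=; have [g [h [Hg Hh ->]]] := homog_split f.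
rewrite !linearD /= mulrDr (homog_sgn Hg) (homog_sgn Hh) expr0 mul1r expr1 mulN1r.
rewrite !linearN /= (homog_sgn (phip _ _ Hg)) (homog_sgn (phip _ _ Hh)) addbF.
by congr (_ + _); case: (p); rewrite ?expr0 ?expr1 ?mulN1r ?mul1r ?opprK.
Qed.

End Differential.

Section Juxtaposition.
Variables (k : comNzRingType) (a m n : nat) (amn : (a + m <= n)%N).

Fact shift_strand_subproof (j : 'I_m) : (a + j < n)%N.
Proof. by case: j => j /=; lia. Qed.
Definition shift_strand (j : 'I_m) : 'I_n := Ordinal (shift_strand_subproof j).

Fact shift_crossing_subproof (j : 'I_m.-1) : (a + j < n.-1)%N.
Proof. by case: j => j /=; lia. Qed.
Definition shift_crossing (j : 'I_m.-1) : 'I_n.-1 :=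
  Ordinal (shift_crossing_subproof j).

Definition place_gen (g : ONH_gen m) : ONH k n :=
  match g with
  | Dot j => dot (shift_strand j)
  | Crossing j => crossing (shift_crossing j)
  end.

(* Horizontal juxtaposition of a diagram on [m] strands with [a] vertical
   strands on its left and [n - a - m] on its right. *)
Definition place : ONH k m -> ONH k n := plift (pcst (@ONH_rel k n)) place_gen.

Fact place_rels u v : ONH_rel u v ->
  plift_expr (pcst (@ONH_rel k n)) place_gen u =
  plift_expr (pcst (@ONH_rel k n)) place_gen v.
Proof.
case=> {u v} [i j ij|i j ij|i|i j ij|i j ij|i|i] /=;
  rewrite /dot /crossing /pgen -?(pclassM _ (Gen _) (Gen _)) -?pclassM -?pclassD; apply/pclassP/nc_rel.
- by apply: ONH_dot_dot; rewrite -val_eqE /= eqn_add2l.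
- by apply: ONH_far => /=; lia.
- exact: ONH_sq.
- by apply: ONH_braid => /=; lia.
- by apply: ONH_cross_dot; move: ij; rewrite !touchesE /=; lia.
- have -> : shift_strand (lo i) = lo (shift_crossing i) by exact: val_inj.
  have -> : shift_strand (hi i) = hi (shift_crossing i).
    by apply: val_inj => /=; rewrite addnS.
  exact: ONH_slide_l.
- have -> : shift_strand (lo i) = lo (shift_crossing i) by exact: val_inj.
  have -> : shift_strand (hi i) = hi (shift_crossing i).
    by apply: val_inj => /=; rewrite addnS.
  exact: ONH_slide_r.
Qed.

Lemma place_dot j : place (dot j) = dot (shift_strand j).
Proof. exact: (plift_gen (@pcst_central _ _ _) place_rels). Qed.
Lemma place_crossing j : place (crossing j) = crossing (shift_crossing j).
Proof. exact: (plift_gen (@pcst_central _ _ _) place_rels). Qed.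
Lemma place_cst s : place (pcst _ s) = pcst _ s.
Proof. exact: (plift_cst (@pcst_central _ _ _) place_rels). Qed.
Lemma placeD u v : place (u + v) = place u + place v.
Proof. exact: (pliftD (@pcst_central _ _ _) place_rels). Qed.
Lemma placeM u v : place (u * v) = place u * place v.
Proof. exact: (pliftM (@pcst_central _ _ _) place_rels). Qed.

End Juxtaposition.

Section Locality.
Variables (k : comNzRingType) (n : nat).

Fact strand_subproof (i : 'I_n) : (i + 1 <= n)%N.
Proof. by rewrite addn1. Qed.
Definition on_strand (i : 'I_n) : ONH k 1 -> ONH k n := place (strand_subproof i).

Fact crossing_subproof (i : 'I_n.-1) : (i + 2 <= n)%N.
Proof. by case: i => i /=; lia. Qed.
Definition on_crossing (i : 'I_n.-1) : ONH k 2 -> ONH k n :=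
  place (crossing_subproof i).

(* ONH_n as a subset of END(OPol_n). *)
Definition in_ONH (phi : OPol k n -> OPol k n) : Prop :=
  exists u : ONH k n, phi =1 rho u.

Definition diagrammatically_local (alpha : {ffun 'I_n -> bool}) : Prop :=
  [/\ forall u : ONH k n, in_ONH (dEND alpha (rho u)),
      dEND alpha (rho (1 : ONH k n)) =1 (fun=> 0)
    & exists (D1 : ONH k 1) (D2 : ONH k 2),
        (forall i : 'I_n,
           dEND alpha (rho (dot i)) =1 rho (on_strand i D1)) /\
        (forall i : 'I_n.-1,
           dEND alpha (rho (crossing i)) =1 rho (on_crossing i D2))].

End Locality.

(* Main.v *)
Require Import Defs.
From mathcomp Require Import all_boot ssralg.
From HB Require Import structures.
From mathcomp Require Import fingroup perm.

(** Put [c = alpha_i + alpha_(i+1) - 1]. A direct computation with the Leibniz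
    rules gives [d(∂_i) = 1 + c s_i] as operators on [OPol_n]. The operators in
    [ONH_n] commute with right multiplication by any [g] killed by all the
    [∂_j], for example [g = x_1 - x_2 + x_3 - ...]; but [s_i g - g] is
    [2 (x_(i+1) - x_i)] up to sign, so [d(∂_i)] can lie in [ONH_n] only if
    [2 c = 0]. As [c] is [-1], [0] or [1] and [2 <> 0], this forces [c = 0]. *)

Import GRing.Theory.
Local Open Scope ring_scope.

Section DifferentialOfCrossing.
Variables (k : comNzRingType) (n : nat).
Local Notation M := (OPol k n).

Lemma lo_neq_hi (i : 'I_n.-1) : lo i != hi i.
Proof. by rewrite -val_eqE /= ltn_eqF. Qed.

(** [demaz i] lowers degree by one, hence is odd; this turns the supercommutator in [dEND] into an
    anticommutator. *)
Lemma sgn_demaz_sgn (i : 'I_n.-1) (f : M) : sgn (demaz i (sgn f)) = - demaz i f.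
Proof.
elim/OPol_ind: f => [|f g IHf IHg|s f IHf|j f IHf].
- by rewrite sgn1 demaz1 linear0 oppr0.
- by rewrite !linearD /= IHf IHg.
- by rewrite !linearZ /= IHf.
- rewrite sgnM sgnX mulNr linearN /= !demazXM linearN linearB linearMn /= sgnK.
  by rewrite sgnM sgnX IHf mulrNN.
Qed.

Lemma demaz_sgn (i : 'I_n.-1) (f : M) : demaz i (sgn f) = - sgn (demaz i f).
Proof. by rewrite -[LHS]sgnK sgn_demaz_sgn linearN. Qed.

(* Both sides are [(id, swapX i)]-derivations that agree on generators. *)
Lemma dOPol_demaz_anticomm (i : 'I_n.-1) (f : M) :
  dOPol (demaz i f) + demaz i (dOPol f) = f - swapX i f.
Proof.
elim/OPol_ind: f => [|f g IHf IHg|s f IHf|j f IHf].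
- rewrite demaz1 linear0 [dOPol 1]dOPol_cst linear0 [swapX i 1]swapX_cst.
  by rewrite addr0 subrr.
- by rewrite !linearD /= addrACA IHf IHg addrACA.
- by rewrite !linearZ /= -!scalerDr IHf.
have sqE : X k j ^+ 2 = X k j * X k j by exact: expr2.
have sgn_sq : swapX i (sgn (X k j ^+ 2)) = X k (tperm (lo i) (hi i) j) ^+ 2.
  by rewrite sqE sgnM sgnX mulrNN swapXM swapXX expr2.
have demaz_sq_gen : demaz i (X k j ^+ 2) = X k j - X k (tperm (lo i) (hi i) j).
  rewrite sqE demazXM demazX /touches.
  case: tpermP => [->|->|/eqP/negPf -> /eqP/negPf ->];
    by rewrite ?eqxx ?orbT ?mulr1 ?mulr1n // mulr0 mulr0n !subrr.
rewrite demazXM linearB linearMn /= !dOPolM !dOPolX !sgnX !mulNr.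
rewrite [demaz i (_ - _)]linearB /= demazXM demazM sgn_sq demaz_sq_gen swapXM swapXX.
set t := X k (tperm _ _ _).
have -> : X k j * f - t * swapX i f = (X k j - t) * f + t * (f - swapX i f).
  by rewrite mulrBl mulrBr addrA subrK.
(* [A] and [B] each come once from [dOPol (demaz i _)] and once, with the opposite sign, from
   [demaz i (dOPol _)], so they cancel. *)
rewrite -IHf mulrDr; set A := dOPol f *+ _; set B := t ^+ 2 * _.
rewrite !opprB addrACA [A + _]addrC addrACA [A + _]addrC subrK.
by rewrite -[_ + B + _]addrA [B + _]addrC subrK addrA.
Qed.

Lemma demaz_linear_form (i : 'I_n.-1) (a : 'I_n -> k) :
  demaz i (\sum_(j < n) a j *: X k j) = (a (lo i) + a (hi i)) *: (1 : M).
Proof.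
rewrite linear_sum (bigD1 (lo i)) //= (bigD1 (hi i)) /=; last first.
  by rewrite eq_sym lo_neq_hi.
rewrite big1 => [|j /andP[jl jh]].
  by rewrite !linearZ /= !demazX /touches !eqxx orbT addr0 scalerDl.
by rewrite linearZ /= demazX /touches (negPf jl) (negPf jh) scaler0.
Qed.

Lemma dEND_crossing (alpha : {ffun 'I_n -> bool}) (i : 'I_n.-1) (f : M) :
  dEND alpha (rho (crossing i)) f =
  f - swapX i f + swapX i f *+ (alpha (lo i) + alpha (hi i))%N.
Proof.
rewrite /dEND /sgnEND !rho_crossing -[dmod alpha f]sgnK sgn_demaz_sgn.
rewrite sgnK opprK /dmod; set A := \sum_(j < n) _.
have demazA : demaz i A = (alpha (lo i) + alpha (hi i))%:R.
  by rewrite demaz_linear_form -natrD scaler_nat.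
(* By oddness [sgn (demaz i f) * A] and [demaz i (sgn f) * A] cancel; the twist leaves only
   [swapX i f * demaz i A]. *)
rewrite linearD /= [demaz i (_ * A)]demazM sgnK demazA demaz_sgn mulNr mulr_natr.
by rewrite addrACA dOPol_demaz_anticomm [X in _ + X]addrA subrr add0r.
Qed.

(** Dots multiply on the left, and the second Leibniz term of a crossing vanishes on [g]. *)
Lemma rho_mulr (u : ONH k n) (f g : M) :
  (forall i : 'I_n.-1, demaz i g = 0) -> rho u (f * g) = rho u f * g.
Proof.
move=> g0; elim/palg_rect_gen: u f => [s|[j|i]|u v IHu IHv|u v IHu IHv] f.
- by rewrite !rho_cst pscaleAl.
- by rewrite !rho_dot mulrA.
- by rewrite !rho_crossing demazM g0 mulr0 addr0.
- by rewrite !rhoD IHu IHv mulrDl.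
- by rewrite !rhoM IHv IHu.
Qed.

(** The first odd elementary symmetric polynomial: adjacent coefficients are opposite, so every
    [demaz i] kills it. *)
Definition altX : M := \sum_(j < n) (-1) ^+ j *: X k j.

Lemma demaz_altX (i : 'I_n.-1) : demaz i altX = 0.
Proof. by rewrite demaz_linear_form exprS mulN1r subrr scale0r. Qed.

(* Evaluation of [x_i] at [1] and of all other variables at [0]; this respects
   anticommutativity because products of distinct variables vanish. *)
Definition eval_axis (i : 'I_n) : M -> k := plift idfun (fun j => (j == i)%:R).

Lemma eval_axis_rels (i : 'I_n) a b : OPol_rel a b ->
  plift_expr (idfun : k -> k) (fun j => (j == i)%:R) a =
  plift_expr (idfun : k -> k) (fun j => (j == i)%:R) b.
Proof.
case=> j l jl /=; case: (eqVneq j i) jl => [->|_ _]; last by rewrite mul0r mulr0 addr0.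
by rewrite eq_sym => /negPf ->; rewrite mul0r mulr0 addr0.
Qed.

Lemma eval_axisX (i j : 'I_n) : eval_axis i (X k j) = (j == i)%:R.
Proof. exact: (plift_gen (cst := idfun) (@mulrC k) (@eval_axis_rels i)). Qed.

Fact eval_axis_linear (i : 'I_n) : linear_for *%R (eval_axis i).
Proof.
move=> s f g; rewrite pscaleE /eval_axis.
rewrite (pliftD (cst := idfun) (@mulrC k) (@eval_axis_rels i)).
rewrite (pliftM (cst := idfun) (@mulrC k) (@eval_axis_rels i)).
by rewrite (plift_cst (cst := idfun) (@mulrC k) (@eval_axis_rels i)).
Qed.
HB.instance Definition _ (i : 'I_n) :=
  GRing.isLinear.Build k M k *%R (eval_axis i) (eval_axis_linear i).

Lemma eval_axis_altX (i : 'I_n) : eval_axis i altX = (-1) ^+ i.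
Proof.
rewrite linear_sum (bigD1 i) //= big1 => [|j ji].
  by rewrite linearZ /= eval_axisX eqxx mulr1 addr0.
by rewrite linearZ /= eval_axisX (negPf ji) mulr0.
Qed.

Lemma eval_axis_swapX_altX (i : 'I_n.-1) :
  eval_axis (lo i) (swapX i altX) = - (-1) ^+ i.
Proof.
rewrite !linear_sum (bigD1 (hi i)) //= big1 => [|j jh].
  by rewrite !linearZ /= swapXX eval_axisX tpermR eqxx mulr1 addr0 exprS mulN1r.
rewrite !linearZ /= swapXX eval_axisX.
by rewrite (canF_eq (tpermK _ _)) tpermL (negPf jh) mulr0.
Qed.

Lemma crossing_weight (alpha : {ffun 'I_n -> bool}) (i : 'I_n.-1) :
  (2 : k) != 0 -> in_ONH (dEND alpha (rho (crossing i : ONH k n))) ->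
  (alpha (lo i) + alpha (hi i) = 1)%N.
Proof.
move=> two_neq0 [u uE].
(* Let [w] be the sum of the two [alpha] values. The operator sends [1] to [w], so it must send
   [altX] to [w] times [altX]; comparing coefficients at strand [lo i] gives [2 (1 - w) = 0] up to
   sign. *)
have := rho_mulr u 1 altX demaz_altX; rewrite mul1r -!uE !dEND_crossing.
rewrite [swapX i 1]swapX_cst subrr add0r mulr_natl.
move/(congr1 (eval_axis (lo i))).
rewrite linearD linearB !linearMn /= eval_axis_altX eval_axis_swapX_altX opprK.
have scaled_sign (a : k) : a * (-1) ^+ i = 0 -> a = 0.
  by move=> a0; rewrite -[a](signrMK i) [_ * a]mulrC a0 mulr0.
(* The cases to exclude are [w = 2], then [w = 0]. *)
case: (alpha _) (alpha _) => [] [] //= E; case/eqP: two_neq0.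
- by apply: scaled_sign; rewrite mulr_natl -E mulNrn mulr2n subrr.
- by apply: scaled_sign; rewrite mulr_natl mulr2n -[RHS]E addr0.
Qed.

End DifferentialOfCrossing.

Theorem proposition3p3 (k : comNzRingType) (two_neq0 : (2 : k) != 0)
    (n : nat) (alpha : {ffun 'I_n -> bool}) :
  diagrammatically_local k alpha ->
  (forall i : 'I_n.-1,
     dEND alpha (rho (crossing i : ONH k n)) =1 rho (1 : ONH k n)) /\
  ((forall i : 'I_n, alpha i = odd i) \/ (forall i : 'I_n, alpha i = ~~ odd i)).
Proof.
case=> preserved _ _.
have weight i := @crossing_weight k n alpha i two_neq0 (preserved (crossing i)).
split=> [i f|]; first by rewrite dEND_crossing weight subrK rho1.
have alternate (i : 'I_n.-1) : alpha (hi i) = ~~ alpha (lo i).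
  by have := weight i; case: (alpha (lo i)) (alpha (hi i)) => [] [].
case: n alpha {preserved weight} alternate => [|n] alpha alternate.
  by left; case.
(* Alternation propagates from strand [0], whose value selects one of the two patterns. *)
suff alphaE (i : 'I_n.+1) : alpha i = alpha ord0 (+) odd i.
  by case: (alpha ord0) alphaE => alphaE; [right|left] => i; rewrite alphaE.
case: i; elim=> [|m IHm] lt_m_n.
  by rewrite addbF; congr (alpha _); exact: val_inj.
have -> : Ordinal lt_m_n = hi (Ordinal (lt_m_n : (m < n.+1.-1)%N)) by exact: val_inj.
rewrite alternate /= addbN -(IHm (ltnW lt_m_n)); congr (~~ alpha _).
exact: val_inj.
Qed.
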